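(* The restricted standard wreath product $G\wr H$ of a sofic group $G$ and a residually finite group $H$ is sofic.
   Context: The restricted standard wreath product $G\wr H$ is the semidirect product $H\ltimes B$, where the base group $B$ is the group of all functions $b:H\to G$ with finite support under pointwise multiplication, and $H$ acts on $B$ on the right by $b^h(h')=b(h'h^{-1})$. Elements are written $hb$ ($h\in H$, $b\in B$), with $(h_1b_1)(h_2b_2)=h_1h_2\,b_1^{h_2}b_2$. Sofic groups are defined as follows (Elek–Szabó). For a finite nonempty set $X$ and $\epsilon>0$, two permutations of $X$ are $\epsilon$-similar if they agree on at least a proportion $1-\epsilon$ of the points of $X$, and they are $(1-\epsilon)$-different if they disagree on at least a proportion $1-\epsilon$ of the points of $X$. For a group $G$, a finite subset $F\subseteq G$ and $\epsilon>0$, an $(F,\epsilon)$-quasi-action of $G$ on $X$ is a map $\phi:G\to\mathrm{Sym}(X)$ such that: $\phi(1)$ is $\epsilon$-similar to the identity; $\phi(e)\phi(f)$ is $\epsilon$-similar to $\phi(ef)$ for all $e,f\in F$; and $\phi(e)$ is $(1-\epsilon)$-different from the identity for every $e\in F\setminus\{1\}$. The group $G$ is sofic if for each $\epsilon\in(0,1)$ and each finite subset $F$ of $G$ there is an $(F,\epsilon)$-quasi-action of $G$ on some finite nonempty set. *)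

(* Defs.v *)
From HB Require Import structures.
From mathcomp Require Import all_boot all_order all_algebra all_fingroup.
From mathcomp Require Import finmap.
From mathcomp Require Import reals.

Set Implicit Arguments.
Unset Strict Implicit.
Unset Printing Implicit Defensive.

Import Order.TTheory GRing.Theory Num.Theory.

Local Open Scope fset_scope.
Local Open Scope ring_scope.
Local Open Scope group_scope.

Definition perm_similar (R : realType) (X : finType) (eps : R)
    (s t : {perm X}) : Prop :=
  ((1 - eps) * #|X|%:R <= #|[set x | s x == t x]|%:R)%R.

Definition perm_different (R : realType) (X : finType) (delta : R)
    (s t : {perm X}) : Prop :=
  (delta * #|X|%:R <= #|[set x | s x != t x]|%:R)%R.

(* Products in {perm X} are read from left to right: (s * t) x = t (s x). *)
Definition quasi_action (R : realType) (G : groupType) (F : {fset G}) (eps : R)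
    (X : finType) (phi : G -> {perm X}) : Prop :=
  [/\ perm_similar eps (phi 1) 1,
      {in F &, forall e f, perm_similar eps (phi e * phi f) (phi (e * f))} &
      {in F, forall e, e != 1 -> perm_different (1 - eps)%R (phi e) 1}].

Definition sofic (R : realType) (G : groupType) : Prop :=
  forall (eps : R) (F : {fset G}), (0 < eps)%R -> (eps < 1)%R ->
  exists (X : finType) (phi : G -> {perm X}),
    (0 < #|X|)%N /\ quasi_action F eps phi.

Definition residually_finite (H : groupType) : Prop :=
  forall h : H, h != 1 ->
  exists (Q : finGroupType) (f : {multiplicative H -> Q}), f h != 1.

Definition wreath_base (G H : groupType) : Type := {fsfun H -> G with 1}.

HB.instance Definition _ (G H : groupType) :=
  Choice.copy (wreath_base G H) {fsfun H -> G with 1}.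

Section WreathBase.
Variables G H : groupType.
Implicit Types (b c : wreath_base G H) (h : H).

Lemma baseP b c : b =1 c -> b = c.
Proof. by move=> e; apply/fsfunP. Qed.

Definition base_one : wreath_base G H := [fsfun with 1].

Definition base_mul b c : wreath_base G H :=
  [fsfun x in finsupp b `|` finsupp c => b x * c x].

Definition base_inv b : wreath_base G H := [fsfun x in finsupp b => (b x)^-1].

(* b^h (h') = b (h' h^-1) *)
Definition base_act b h : wreath_base G H :=
  [fsfun x in [fset y * h | y in finsupp b] => b (x * h^-1)].

Lemma base_oneE x : base_one x = 1.
Proof. by rewrite fsfunE. Qed.

Lemma base_mulE b c x : base_mul b c x = b x * c x.
Proof.
rewrite fsfunE in_fsetU !mem_finsupp.
by do 2 case: eqP => [->|//] /=; rewrite mulg1.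
Qed.

Lemma base_invE b x : base_inv b x = (b x)^-1.
Proof.
rewrite fsfunE mem_finsupp.
by case: eqP => [->|//] /=; rewrite invg1.
Qed.

Lemma base_actE b h x : base_act b h x = b (x * h^-1).
Proof.
rewrite fsfunE; case: imfsetP => // nbx.
apply/esym/fsfun_dflt/negP => bx; apply: nbx.
by exists (x * h^-1) => //; rewrite mulgVK.
Qed.

Fact base_mulA : associative base_mul.
Proof. by move=> a b c; apply: baseP => x; rewrite !base_mulE mulgA. Qed.

Fact base_mul1 : left_id base_one base_mul.
Proof. by move=> a; apply: baseP => x; rewrite base_mulE base_oneE mul1g. Qed.

Fact base_mulr1 : right_id base_one base_mul.
Proof. by move=> a; apply: baseP => x; rewrite base_mulE base_oneE mulg1. Qed.

Fact base_mulV : left_inverse base_one base_inv base_mul.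
Proof.
by move=> a; apply: baseP => x; rewrite base_mulE base_invE base_oneE mulVg.
Qed.

Fact base_mulrV : right_inverse base_one base_inv base_mul.
Proof.
by move=> a; apply: baseP => x; rewrite base_mulE base_invE base_oneE mulgV.
Qed.

HB.instance Definition _ := isGroup.Build (wreath_base G H)
  base_mulA base_mul1 base_mulr1 base_mulV base_mulrV.

Lemma base_act1 b : base_act b 1 = b.
Proof. by apply: baseP => x; rewrite base_actE invg1 mulg1. Qed.

Lemma base_actM b h k : base_act b (h * k) = base_act (base_act b h) k.
Proof. by apply: baseP => x; rewrite !base_actE invgM mulgA. Qed.

Lemma base_1act h : base_act 1 h = 1.
Proof. by apply: baseP => x; rewrite base_actE !base_oneE. Qed.

Lemma base_Mact b c h : base_act (b * c) h = base_act b h * base_act c h.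
Proof.
apply: baseP => x.
by rewrite base_actE [LHS]base_mulE [RHS]base_mulE !base_actE.
Qed.

End WreathBase.

(* Wreath h b stands for the element h b of the semidirect product, with
   (h1 b1) (h2 b2) = (h1 h2) (b1^h2 b2). *)
Record wreath (G H : groupType) :=
  Wreath { wreath_top : H; wreath_bot : wreath_base G H }.

Section Wreath.
Variables G H : groupType.
Implicit Types x y : wreath G H.

Definition wreath_pair x := (wreath_top x, wreath_bot x).
Definition pair_wreath (p : H * wreath_base G H) := Wreath p.1 p.2.

Lemma wreath_pairK : cancel wreath_pair pair_wreath.
Proof. by case. Qed.

HB.instance Definition _ := Choice.copy (wreath G H) (can_type wreath_pairK).

Definition wreath_one : wreath G H := Wreath 1 1.

Definition wreath_mul x y : wreath G H :=
  Wreath (wreath_top x * wreath_top y)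
         (base_act (wreath_bot x) (wreath_top y) * wreath_bot y).

Definition wreath_inv x : wreath G H :=
  Wreath (wreath_top x)^-1 (base_act (wreath_bot x)^-1 (wreath_top x)^-1).

Fact wreath_mulA : associative wreath_mul.
Proof.
by case=> h b [k c] [l d]; rewrite /wreath_mul /= base_Mact base_actM !mulgA.
Qed.

Fact wreath_mul1 : left_id wreath_one wreath_mul.
Proof. by case=> h b; rewrite /wreath_mul /= base_1act !mul1g. Qed.

Fact wreath_mulr1 : right_id wreath_one wreath_mul.
Proof. by case=> h b; rewrite /wreath_mul /= base_act1 !mulg1. Qed.

Fact wreath_mulV : left_inverse wreath_one wreath_inv wreath_mul.
Proof.
case=> h b; rewrite /wreath_mul /= -base_actM mulVg base_act1.
by rewrite mulVg.
Qed.

Fact wreath_mulrV : right_inverse wreath_one wreath_inv wreath_mul.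
Proof.
by case=> h b; rewrite /wreath_mul /= -base_Mact !mulgV base_1act.
Qed.

HB.instance Definition _ := isGroup.Build (wreath G H)
  wreath_mulA wreath_mul1 wreath_mulr1 wreath_mulV wreath_mulrV.

End Wreath.

(* Main.v *)
Require Import Defs.
From HB Require Import structures.
From mathcomp Require Import all_boot all_order all_algebra all_fingroup.
From mathcomp Require Import finmap reals.
From mathcomp Require Import ring.

(** Let [F] be a finite subset of the wreath product and [eps > 0].  Residual
    finiteness of [H] gives a homomorphism [f] to a finite group [Q] that is
    injective on any prescribed finite set [K] of [H] ([residually_finite_inj]).
    Taking for [K] a set that contains the tops of the elements of [F] and all
    the supports involved in products of two elements of [F], the computations
    to be modelled take place in [wreath G Q]: a base function is transported
    to [Q] along [f] ([transport]), and this respects products and, because [f]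
    is injective on [K], translations ([transport_act]).

    For a permutation representation of [G] on [Y], the group [wreath G Q] acts
    on [Q * Y^Q]: [Q] translates the first factor and the coordinates of the
    second one, and a base function acts on [Y^Q] coordinatewise.  The same
    formula ([wreath_perm]) makes sense for a quasi-action of [G] on [Y], and
    it is compatible with composition ([wreath_permM]), so the only errors are
    those in the [#|Q|] coordinates.  If each has proportion at most
    [eps / #|Q|], the proportion of points of [Y^Q] with an error in some
    coordinate is at most [eps] ([wreath_perm_similar], by Bernoulli's
    inequality).  As [Q] is chosen before the quasi-action of [G], this
    accuracy can be imposed on the latter.

    Finally an element of [F] with nontrivial top moves every point, through
    the factor [Q] ([wreath_perm_fixfree]); one with trivial top and nontrivial
    base moves almost all points, through a single coordinate where its base
    function is nontrivial ([wreath_perm_different]). *)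

Set Implicit Arguments.
Unset Strict Implicit.
Unset Printing Implicit Defensive.

Import Order.TTheory GRing.Theory Num.Theory.
Local Open Scope fset_scope.
Local Open Scope ring_scope.
Local Open Scope group_scope.

(** * Finite quotients of residually finite groups *)

Section PairMorphism.
Variables (H : groupType) (Q1 Q2 : finGroupType).
Variables (f1 : {multiplicative H -> Q1}) (f2 : {multiplicative H -> Q2}).

Definition pair_mul (h : H) : Q1 * Q2 := (f1 h, f2 h).

Fact pair_mul_multiplicative : {morph pair_mul : x y / x * y}.
Proof. by move=> x y; rewrite /pair_mul !gmulfM. Qed.

HB.instance Definition _ := isMultiplicative.Build H (Q1 * Q2)%type pair_mul
  pair_mul_multiplicative.
End PairMorphism.

(** Finitely many elements are detected together in the product of the finite
    quotients that detect each of them. *)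
Lemma residually_finite_seq (H : groupType) (D : seq H) :
  residually_finite H ->
  exists (Q : finGroupType) (f : {multiplicative H -> Q}),
    {in D, forall h, h != 1 -> f h != 1}.
Proof.
move=> rfH; elim: D => [|d D [Q [f fD]]].
  by exists {perm bool}, (one_fun {perm bool} : {multiplicative H -> _}).
have [-> | /rfH[Q' [f' f'd]]] := eqVneq d 1.
  by exists Q, f => h; rewrite in_cons => /predU1P[->|/fD//]; rewrite eqxx.
exists (Q' * Q)%type, (pair_mul f' f : {multiplicative H -> _}) => h.
rewrite in_cons => /predU1P[->|hD] h1; apply/eqP => -[].
  by move/eqP: f'd.
by move=> _; apply/eqP/fD.
Qed.

Lemma multiplicative1 (H Q : groupType) (f : {multiplicative H -> Q}) :
  f 1 = 1.
Proof. by apply: (mulgI (f 1)); rewrite -gmulfM !mulg1. Qed.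

Lemma residually_finite_inj (H : groupType) (K : seq H) :
  residually_finite H ->
  exists (Q : finGroupType) (f : {multiplicative H -> Q}),
    {in K &, injective f}.
Proof.
move=> /(residually_finite_seq [seq x * y^-1 | x <- K, y <- K])[Q [f fK]].
exists Q, f => x y xK yK fxy; apply/eqP/negPn/negP => neq_xy.
have /fK : x * y^-1 \in [seq x * y^-1 | x <- K, y <- K].
  exact: allpairs_f.
case/(_ _)/eqP.
  by apply: contraNneq neq_xy => /divg1_eq->.
by apply: (mulIg (f y)); rewrite -gmulfM mulgVK mul1g.
Qed.

(** * Transporting base functions to a finite quotient *)

Section Transport.
Variables (G H : groupType) (Q : finGroupType) (f : {multiplicative H -> Q}).
Variable K : seq H.
Hypothesis injf : {in K &, injective f}.
Implicit Types (b c : wreath_base G H) (h x : H) (q : Q).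

(** The fibre of [f] in [K] over [q] has at most one element; [head] extracts
    the value of [b] there, and is [1] on an empty fibre. *)
Definition transport b q : G := head 1 [seq b x | x <- K & f x == q].

Lemma transportM b c q : transport (b * c) q = transport b q * transport c q.
Proof.
rewrite /transport; case: [seq _ <- K | _] => [|x s] /=; first by rewrite mulg1.
exact: base_mulE.
Qed.

Lemma transport_one q : transport 1 q = 1.
Proof.
by rewrite /transport; case: [seq _ <- K | _] => [|x s] //=; rewrite base_oneE.
Qed.

Lemma transportE b x : x \in K -> transport b (f x) = b x.
Proof.
move=> xK; rewrite /transport.
have: x \in [seq z <- K | f z == f x] by rewrite mem_filter eqxx.
case Es: [seq z <- K | f z == f x] => [|z s] //= _.
have: z \in [seq z <- K | f z == f x] by rewrite Es mem_head.
by rewrite mem_filter => /andP[/eqP fz zK]; rewrite (injf zK xK fz).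
Qed.

Lemma transport_neq1 b q :
  transport b q != 1 -> exists2 x, x \in K & f x = q /\ b x != 1.
Proof.
rewrite /transport.
case Es: [seq z <- K | f z == q] => [|z s] /=; first by rewrite eqxx.
have: z \in [seq z <- K | f z == q] by rewrite Es mem_head.
by rewrite mem_filter => /andP[/eqP fz zK] bz; exists z.
Qed.

(** Both sides can only be nontrivial over the image of the support of [b],
    translated by [h]; as [K] contains the support and its translate, both are
    then read off at corresponding points of [K]. *)
Lemma transport_act b h q :
    {subset finsupp b <= K} -> {subset finsupp (base_act b h) <= K} ->
  transport (base_act b h) q = transport b (q * (f h)^-1).
Proof.
move=> bK bhK.
have act_supp x : b x != 1 -> x * h \in K.
  by move=> bx; apply: bhK; rewrite mem_finsupp base_actE mulgK.
have [b1|] := eqVneq (transport b (q * (f h)^-1)) 1; last first.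
  case/transport_neq1 => x xK [fx bx].
  have -> : q = f (x * h) by rewrite gmulfM fx mulgVK.
  rewrite gmulfM mulgK transportE // -gmulfM transportE ?act_supp //.
  by rewrite base_actE mulgK.
rewrite b1; apply/eqP/negPn/negP => /transport_neq1[x xK [fx]].
rewrite base_actE => bxh; have xhK : x * h^-1 \in K by rewrite bK ?mem_finsupp.
have fxh : f (x * h^-1) = q * (f h)^-1.
  by apply: (mulIg (f h)); rewrite -gmulfM !mulgVK.
by move/eqP: b1; rewrite -fxh transportE // (negPf bxh).
Qed.

End Transport.

(** * The wreath product action on [Q * Y^Q] *)

Section WreathPerm.
Variables (Q : finGroupType) (Y : finType).
Implicit Types (h : Q) (s t : Q -> {perm Y}).

(** The right action of the element of the wreath product of [{perm Y}] and [Q]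
    with top [h] and base function [s]: the coordinates are first translated by
    [h], then permuted separately. *)
Definition wreath_fun h s (p : Q * {ffun Q -> Y}) : Q * {ffun Q -> Y} :=
  (p.1 * h, [ffun x => s x (p.2 (x * h^-1))]).

Lemma wreath_fun_inj h s : injective (wreath_fun h s).
Proof.
move=> [q y] [q' y'] [/mulIg-> /ffunP eq_y]; congr pair; apply/ffunP => x.
by have := eq_y (x * h); rewrite !ffunE mulgK => /perm_inj.
Qed.

Definition wreath_perm h s : {perm Q * {ffun Q -> Y}} :=
  perm (@wreath_fun_inj h s).

Lemma wreath_perm1 : wreath_perm 1 (fun=> 1) = 1.
Proof.
apply/permP => -[q y]; rewrite !permE /wreath_fun mulg1; congr pair.
by apply/ffunP => x; rewrite ffunE perm1 invg1 mulg1.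
Qed.

(** This is the multiplication of the semidirect product: moving [s] past the
    translation [k] turns it into its translate by [k]. *)
Lemma wreath_permM h k s t :
  wreath_perm h s * wreath_perm k t =
  wreath_perm (h * k) (fun x => s (x * k^-1) * t x).
Proof.
apply/permP => -[q y]; rewrite permM !permE /wreath_fun /= mulgA; congr pair.
by apply/ffunP => x; rewrite !ffunE permM invMg mulgA.
Qed.

Lemma card_coordinates (A : Q -> {set Y}) :
  #|[set p : Q * {ffun Q -> Y} | [forall x, p.2 x \in A x]]| =
  (#|Q| * \prod_x #|A x|)%N.
Proof.
have -> : (\prod_x #|A x|)%N =
    #|[set y : {ffun Q -> Y} | [forall x, y x \in A x]]|.
  rewrite cardsE -[RHS]/#|(family A)| card_family.
  by rewrite foldrE big_map big_enum.
rewrite -cardsT -cardsX; apply: eq_card => -[q y].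
by rewrite !inE.
Qed.

End WreathPerm.

(** * Proportions of agreement and disagreement *)

Lemma Bernoulli (R : realType) (x : R) n :
  (0 <= x)%R -> (x <= 1)%R -> (1 - n%:R * x <= (1 - x) ^+ n)%R.
Proof.
move=> x0 x1; elim: n => [|n IH]; first by rewrite mul0r subr0 expr0.
apply: (@le_trans _ _ ((1 - n%:R * x) * (1 - x))%R).
  have -> : ((1 - n%:R * x) * (1 - x) = 1 - n.+1%:R * x + n%:R * x ^+ 2)%R.
    by rewrite -natr1; ring.
  by rewrite lerDl mulr_ge0 ?exprn_ge0.
by rewrite exprSr ler_wpM2r // subr_ge0.
Qed.

Section Proportions.
Variables (R : realType) (Q : finGroupType) (Y : finType).
Implicit Types (h : Q) (s t : Q -> {perm Y}) (eps delta : R).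

Lemma card_wreath_space : #|{: Q * {ffun Q -> Y}}| = (#|Q| * #|Y| ^ #|Q|)%N.
Proof. by rewrite card_prod card_ffun. Qed.

(** The two permutations agree at [(q, y)] as soon as [y] avoids, at each of
    the [#|Q|] coordinates, the points where [s] and [t] disagree. *)
Lemma wreath_perm_similar h s t eps :
    (0 <= eps)%R -> (eps <= 1)%R -> (forall x, perm_similar eps (s x) (t x)) ->
  perm_similar (#|Q|%:R * eps)%R (wreath_perm h s) (wreath_perm h t).
Proof.
move=> eps0 eps1 st; rewrite /perm_similar card_wreath_space.
(* The coordinate [z] of [y] is moved to position [z * h] before [s] and [t]
     act on it, hence the index of the two permutations. *)
pose A z := [set y | s (z * h) y == t (z * h) y].
have -> : [set p | wreath_perm h s p == wreath_perm h t p] =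
          [set p : Q * {ffun Q -> Y} | [forall x, p.2 x \in A x]].
  apply/setP => -[q y]; rewrite !inE !permE /wreath_fun xpair_eqE eqxx /=.
  apply/eqP/forallP => [/ffunP eq_y x | eq_y].
    by have := eq_y (x * h); rewrite !ffunE mulgK inE => ->.
  apply/ffunP => x; have := eq_y (x * h^-1).
  by rewrite !ffunE inE mulgVK => /eqP.
rewrite card_coordinates !natrM mulrCA ler_wpM2l ?ler0n //.
apply: (@le_trans _ _ (\prod_(x : Q) ((1 - eps) * #|Y|%:R))%R).
  rewrite big_split /= !prodr_const natrX ler_wpM2r ?exprn_ge0 //.
  rewrite (_ : #|xpredT| = #|Q|); first exact: Bernoulli.
  by apply: eq_card => x; rewrite !inE.
rewrite natr_prod; apply: ler_prod => x _; rewrite st andbT.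
by rewrite mulr_ge0 // subr_ge0.
Qed.

(** Every point is moved, already in its component in [Q]. *)
Lemma wreath_perm_fixfree h s delta :
  h != 1 -> (delta <= 1)%R -> perm_different delta (wreath_perm h s) 1.
Proof.
move=> h1 delta1; rewrite /perm_different.
have -> : [set p | wreath_perm h s p != (1 : {perm _}) p] = setT.
  apply/setP => -[q y]; rewrite !inE perm1 permE /wreath_fun xpair_eqE.
  by rewrite -[X in _ == X]mulg1 (inj_eq (mulgI q)) (negPf h1).
by rewrite cardsT ler_piMl.
Qed.

(** It suffices to look at the coordinate [x0]: the points whose [x0]-th
    coordinate is moved by [s x0] are moved. *)
Lemma wreath_perm_different s x0 delta :
  perm_different delta (s x0) 1 -> perm_different delta (wreath_perm 1 s) 1.
Proof.
rewrite /perm_different card_wreath_space => ds.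
pose A z := if z == x0 then [set y | s x0 y != (1 : {perm Y}) y] else setT.
apply: (@le_trans _ _
    #|[set p : Q * {ffun Q -> Y} | [forall x, p.2 x \in A x]]|%:R); last first.
  rewrite ler_nat; apply/subset_leq_card/subsetP => -[q y]; rewrite !inE perm1.
  move/forallP/(_ x0); rewrite /A eqxx inE perm1; apply: contraNneq.
  rewrite permE => -[_ /ffunP/(_ x0)]; rewrite ffunE.
  by rewrite invg1 mulg1 => ->.
rewrite card_coordinates !natrM mulrCA ler_wpM2l ?ler0n //.
rewrite (bigD1 x0) //= {1}/A eqxx natrM.
rewrite -(@prednK #|Q|) ?expnS ?natrM ?mulrA; last first.
  by apply/card_gt0P; exists x0.
have -> : (\prod_(i | i != x0) #|A i| = #|Y| ^ #|Q|.-1)%N.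
  rewrite (eq_bigr (fun=> #|Y|)) => [|i /negPf ne].
    by rewrite prod_nat_const cardC1.
  by rewrite /A ne cardsT.
by rewrite ler_wpM2r ?ler0n.
Qed.

End Proportions.

Theorem theorem4p1 (R : realType) (G H : groupType) :
  sofic R G -> residually_finite H -> sofic R (wreath G H).
Proof.
move=> soficG rfH eps F eps0 eps1.
(* The tops and [1] are in [K] so that [f] is nontrivial on nontrivial tops; the
     supports are those required by [transport_act]. *)
pose K : seq H := 1 :: [seq wreath_top w | w <- F] ++
  flatten [seq enum_fset (finsupp (wreath_bot w)) | w <- F] ++
  flatten [seq enum_fset (finsupp (base_act (wreath_bot e) (wreath_top g)))
          | e <- F, g <- F].
have K1 : 1 \in K by rewrite mem_head.
have Ktop w : w \in F -> wreath_top w \in K.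
  by move=> wF; rewrite in_cons mem_cat map_f ?orbT.
have Kbot w : w \in F -> {subset finsupp (wreath_bot w) <= K}.
  move=> wF x xw; rewrite in_cons !mem_cat; apply/or4P/Or43/flatten_mapP.
  by exists w.
have Kact e g : e \in F -> g \in F ->
    {subset finsupp (base_act (wreath_bot e) (wreath_top g)) <= K}.
  move=> eF gF x xe; rewrite in_cons !mem_cat; apply/or4P/Or44/flattenP.
  by eexists; [apply: allpairs_f eF gF | exact: xe].
have [Q [f injf]] := residually_finite_inj K rfH.
have Q0 : (0 < #|Q|)%N by apply/card_gt0P; exists 1.
have Q0R : (0 < #|Q|%:R :> R)%R by rewrite ltr0n.
(* The errors in the [#|Q|] coordinates add up, so each may only be a fraction
     [1 / #|Q|] of the total. *)
pose eps' : R := (eps / #|Q|%:R)%R.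
have eps'0 : (0 < eps')%R by rewrite divr_gt0.
have eps'_le : (eps' <= eps)%R.
  by rewrite ler_pdivrMr // ler_peMr ?ler1n // ltW.
have eps'1 : (eps' < 1)%R := le_lt_trans eps'_le eps1.
have eps'E : eps = (#|Q|%:R * eps')%R by rewrite mulrC divfK // gt_eqF.
pose bar w : Q -> G := transport f K (wreath_bot w).
pose F' : {fset G} := [fset bar w q | w in F, q in Q].
have [Y [phi [Y0 [phi1 phiM phi_diff]]]] := soficG eps' F' eps'0 eps'1.
have F'P w q : w \in F -> bar w q \in F' by move=> wF; apply: in_imfset2.
exists (Q * {ffun Q -> Y})%type.
exists (fun w => wreath_perm (f (wreath_top w)) (fun x => phi (bar w x))).
split; first by rewrite card_wreath_space muln_gt0 Q0 expn_gt0 Y0.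
split.
- (* [phi] need not fix [1], so this costs an error in every coordinate. *)
  rewrite -wreath_perm1 multiplicative1 eps'E.
  apply: wreath_perm_similar => [||x]; rewrite ?ltW //.
  by rewrite /bar transport_one.
- move=> e g eF gF; rewrite wreath_permM -gmulfM eps'E.
  apply: wreath_perm_similar => [||x]; rewrite ?ltW //.
  rewrite {3}/bar transportM transport_act; [|by []|exact: Kbot|exact: Kact].
  by apply: phiM; apply: F'P.
case=> h b eF; set e := Wreath h b; rewrite /= => e1.
have delta1 : (1 - eps <= 1)%R by rewrite gerBl ltW.
have [h1|h1] := eqVneq h 1; last first.
  apply: wreath_perm_fixfree => //; apply: contraNneq h1 => fh.
  by apply/eqP/injf; rewrite ?multiplicative1 //; apply: (Ktop _ eF).
have [x bx] : exists x, b x != 1.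
  have [supp0|[x]] := fset_0Vmem (finsupp b); last first.
    by rewrite mem_finsupp; exists x.
  case/eqP: e1; rewrite /e h1; congr Wreath; apply: baseP => x.
  by rewrite base_oneE fsfun_dflt // supp0 in_fset0.
rewrite h1 multiplicative1; apply: (@wreath_perm_different _ _ _ _ (f x)).
have xK : x \in K by apply: (Kbot _ eF); rewrite mem_finsupp.
have := phi_diff _ (F'P _ (f x) eF); rewrite {1}/bar transportE // => /(_ bx).
apply: le_trans.
by rewrite ler_wpM2r ?ler0n // lerB.
Qed.
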